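(* Let $\mathcal{G}=(\mathcal{V},\mathcal{E})$ be a temporal graph with $|\mathcal{V}|=n$ and $|\mathcal{E}|=m\ge 1$ (edges possibly associated with multiple time intervals), and let $\mathcal{N}^*=\frac{1}{m}\sum_{e\in\mathcal{E}}\mathcal{N}(e)$ be the average overlapping number of the edges of $\mathcal{E}$. Then the greedy algorithm described in the context finds a $\frac{1}{\mathcal{N}^*+1}$-approximate maximum 0-1 timed matching for $\mathcal{G}$, i.e. its output $M$ satisfies $|M|\ge\frac{1}{\mathcal{N}^*+1}|M^{opt}|$ for every maximum 0-1 timed matching $M^{opt}$ of $\mathcal{G}$.
   Context: A temporal graph $\mathcal{G}=(\mathcal{V},\mathcal{E})$ with lifetime $\mathcal{T}$ has a finite node set and a finite edge set; each edge joins two distinct nodes (no self-loops, at most one edge per pair) and is associated with a nonempty list of time intervals $[s_1,f_1),\dots,[s_k,f_k)$ with integers $0\le s_1<f_1<s_2<\dots<s_k<f_k\le\mathcal{T}$, existing at each integer timestep in one of them. Two distinct edges overlap if they share an endpoint and exist at a common timestep. The overlapping number $\mathcal{N}(e)$ of $e\in\mathcal{E}$ is the number of edges of $\mathcal{E}$ overlapping $e$. A 0-1 timed matching is a set of edges no two of which overlap; a maximum one has maximum cardinality. Greedy algorithm: let $E':=\mathcal{E}$, $M:=\emptyset$. While $E'\ne\emptyset$: choose $e\in E'$ whose number of overlapping edges within $E'$ is minimum (ties broken arbitrarily), add $e$ to $M$, and remove $e$ and all edges of $E'$ overlapping $e$ from $E'$. Output $M$. *)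

(* Defs.v *)
From mathcomp Require Import all_boot all_order all_algebra.

Set Implicit Arguments.
Unset Strict Implicit.
Unset Printing Implicit Defensive.

Import GRing.Theory Num.Theory.

(* A pair (s, f) stands for [s, f); the sorted condition on the list of all
   endpoints is s_1 < f_1 < s_2 < ... < s_k < f_k. *)
Definition valid_intervals (T : nat) (l : seq (nat * nat)) : bool :=
  [&& l != [::],
      sorted ltn (flatten [seq [:: p.1; p.2] | p <- l])
    & all (fun p => p.2 <= T) l].

(* An edge is the set of its two endpoints, so there are no self-loops and at
   most one edge per pair. [intervals] is meaningful only on [edges]. *)
Record temporal_graph (V : finType) := TemporalGraph {
  lifetime : nat;
  edges : {set {set V}};
  intervals : {set V} -> seq (nat * nat);
  card_edge : forall e, e \in edges -> #|e| = 2;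
  intervals_valid :
    forall e, e \in edges -> valid_intervals lifetime (intervals e)
}.

Section TemporalGraph.
Variables (V : finType) (G : temporal_graph V).
Implicit Types (e : {set V}) (E M : {set {set V}}).

Definition exists_at (t : nat) e : bool :=
  has (fun p => p.1 <= t < p.2) (intervals G e).

(* All intervals end by the lifetime, so the timesteps at which an edge exists
   are exactly those of 'I_(lifetime G). *)
Definition overlap e1 e2 : bool :=
  [&& e1 != e2, e1 :&: e2 != set0
    & [exists t : 'I_(lifetime G), exists_at t e1 && exists_at t e2]].

Definition overlapping_in E e : {set {set V}} := [set e' in E | overlap e e'].

Definition overlapping_number e : nat := #|overlapping_in (edges G) e|.

Definition avg_overlapping_number : rat :=
  (1 / #|edges G|%:R * \sum_(e in edges G) (overlapping_number e)%:R)%R.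

Definition timed_matching M : Prop :=
  M \subset edges G /\
  (forall e1 e2, e1 \in M -> e2 \in M -> ~~ overlap e1 e2).

Definition maximum_timed_matching M : Prop :=
  timed_matching M /\ (forall M', timed_matching M' -> #|M'| <= #|M|).

Definition approx_maximum_timed_matching (r : rat) M : Prop :=
  timed_matching M /\
  (forall Mopt, maximum_timed_matching Mopt ->
     (r * #|Mopt|%:R <= #|M|%:R)%R).

(* [greedy_loop E M out]: from the state E' = E, M = M, some execution of the
   while loop (some way of breaking ties) ends with output [out]. *)
Inductive greedy_loop : {set {set V}} -> {set {set V}} -> {set {set V}} -> Prop :=
| GreedyStop M : greedy_loop set0 M M
| GreedyStep E M out e of
    e \in E &
    (forall e', e' \in E -> #|overlapping_in E e| <= #|overlapping_in E e'|) &
    greedy_loop (E :\: (e |: overlapping_in E e)) (e |: M) out :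
  greedy_loop E M out.

Definition greedy_output M : Prop := greedy_loop (edges G) set0 M.

Lemma greedy_output_exists : exists M, greedy_output M.
Proof.
rewrite /greedy_output; move: (edges G) (set0 : {set {set V}}) => E.
have [k] := ubnP #|E|; elim: k E => // k IHk E leEk M.
have [->|[e0 e0E]] := set_0Vmem E; first by exists M; constructor.
have [e eE emin] := arg_minnP (fun e => #|overlapping_in E e|) e0E.
have [|out run] := IHk (E :\: (e |: overlapping_in E e)) _ (e |: M); last first.
  by exists out; apply: (GreedyStep eE).
rewrite -ltnS; apply: leq_trans leEk; rewrite ltnS; apply: proper_card.
apply/properP; split; first exact: subsetDl.
by exists e; rewrite // !inE eqxx.
Qed.

End TemporalGraph.

(* Main.v *)
Require Import Defs.
From mathcomp Require Import all_boot all_order all_algebra zify.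

(** Turan-type argument.  If a greedy step picks an edge with [d] overlapping
    edges, it removes [d + 1] edges, each with overlapping number at least [d];
    so [(d + 1) ^ 2] is at most the sum of [N(e) + 1] over the removed edges.
    Summing over the [|M|] steps, Cauchy-Schwarz gives
    [m ^ 2 <= |M| * \sum_e (N(e) + 1) = |M| * m * (N^* + 1)], and no matching
    has more than [m] edges. *)

Import GRing.Theory Num.Theory.

Set Implicit Arguments.
Unset Strict Implicit.
Unset Printing Implicit Defensive.

(* One step of Cauchy-Schwarz, in a form suited to induction on [k]. *)
Lemma sqrnD_leq_mulS (r a k s : nat) :
  a ^ 2 <= k * s -> (r + a) ^ 2 <= k.+1 * (r ^ 2 + s).
Proof.
move=> le_a.
(* The cross term is bounded by AM-GM on [k * r ^ 2] and [s], whose product is at least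
   [(r * a) ^ 2]. *)
have le_ra : 2 * (r * a) <= k * r ^ 2 + s.
  rewrite -leq_sqr; apply: leq_trans (nat_AGM2 _ _).
  by rewrite !expnMn leq_mul2l /= [k * _]mulnC -mulnA leq_mul2l le_a orbT.
rewrite sqrnD mulSn mulnDr; lia.
Qed.

Section Greedy.
Variables (V : finType) (G : temporal_graph V).
Implicit Types (e : {set V}) (E M I : {set {set V}}).

Lemma overlap_irrefl e : overlap G e e = false.
Proof. by rewrite /overlap eqxx. Qed.

Lemma overlapC e1 e2 : overlap G e1 e2 = overlap G e2 e1.
Proof.
rewrite /overlap eq_sym setIC; congr [&& _, _ & _].
by apply: eq_existsb => t; rewrite andbC.
Qed.

Lemma subset_overlapping_in E1 E2 e :
  E1 \subset E2 -> overlapping_in G E1 e \subset overlapping_in G E2 e.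
Proof.
move=> /subsetP sE; apply/subsetP => e'.
by rewrite !inE => /andP[/sE -> ->].
Qed.

Lemma card_removed E e :
  #|e |: overlapping_in G E e| = #|overlapping_in G E e|.+1.
Proof. by rewrite cardsU1 !inE overlap_irrefl andbF. Qed.

Lemma removed_subset E e : e \in E -> e |: overlapping_in G E e \subset E.
Proof.
by move=> eE; apply/subsetP => x; rewrite !inE => /orP[/eqP -> //|/andP[]].
Qed.

(** By minimality of [e], each edge of [R] contributes at least [#|R|] to the right-hand sum; for
    the surviving edges, shrinking [E] can only lower the counts. *)
Lemma removed_sum_leq E e (R := e |: overlapping_in G E e) :
  e \in E ->
  (forall e', e' \in E -> #|overlapping_in G E e| <= #|overlapping_in G E e'|) ->
  #|R| ^ 2 + \sum_(x in E :\: R) #|overlapping_in G (E :\: R) x|.+1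
    <= \sum_(x in E) #|overlapping_in G E x|.+1.
Proof.
move=> eE emin.
have sRE : R \subset E := removed_subset eE.
rewrite [X in _ <= X](big_setID R) /= (setIidPr sRE) leq_add //.
  rewrite -mulnn -sum_nat_const; apply: leq_sum => x xR.
  by rewrite card_removed ltnS emin // (subsetP sRE).
by apply: leq_sum => x _; rewrite ltnS subset_leq_card //
  subset_overlapping_in // subsetDl.
Qed.

(** Induction on the run needs an arbitrary loop state: [I] isolates the edges chosen from here on,
    and overlaps are counted within the current [E], so that the bound composes across steps. *)
Lemma greedy_loop_spec E M out :
  greedy_loop G E M out ->
  exists I, [/\ out = M :|: I, I \subset E,
    forall e1 e2, e1 \in I -> e2 \in I -> ~~ overlap G e1 e2
    & #|E| ^ 2 <= #|I| * \sum_(e in E) #|overlapping_in G E e|.+1].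
Proof.
elim=> {E M out} [M|E M out e eE emin _ [I [-> sI Imatch leI]]].
  exists set0; split; rewrite ?setU0 ?sub0set ?cards0 //.
  by move=> e1 e2; rewrite inE.
have /= le_sum := removed_sum_leq eE emin.
have sRE := removed_subset eE; set R := e |: _ in sI leI le_sum sRE *.
(* Later choices avoid [R], so they differ from [e] and do not overlap it. *)
have noR x : x \in I -> (x \in E) && (x \notin R).
  by move/(subsetP sI); rewrite !inE andbC.
have eI : e \notin I.
  by apply/negP => /noR; rewrite !inE eqxx andbF.
have novl x : x \in I -> ~~ overlap G e x.
  by move/noR => /andP[xE]; rewrite !inE xE negb_or => /andP[].
exists (e |: I); split.
- by rewrite setUCA setUA.
- by rewrite subUset sub1set eE (subset_trans sI) ?subsetDl.
- move=> e1 e2 /setU1P[->|e1I] /setU1P[->|e2I].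
  + by rewrite overlap_irrefl.
  + exact: novl.
  + by rewrite overlapC novl.
  + exact: Imatch.
- rewrite -(cardsID R E) (setIidPr sRE) (cardsU1 e I) eI add1n.
  (* Here [r] is [#|R|] and [a] is the number of surviving edges. *)
  apply: leq_trans (sqrnD_leq_mulS _ leI) _.
  by rewrite leq_mul2l le_sum orbT.
Qed.

Lemma avg_overlapping_numberD1 :
  0 < #|edges G| ->
  (avg_overlapping_number G + 1 =
   (\sum_(e in edges G) (overlapping_number G e).+1)%:R / #|edges G|%:R)%R.
Proof.
move=> m_gt0; rewrite /avg_overlapping_number -natr_sum.
under [in RHS]eq_bigr do rewrite -addn1.
rewrite big_split /= sum1_card natrD mulrDl divff ?pnatr_eq0 -?lt0n //.
by rewrite mul1r mulrC.
Qed.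

End Greedy.

Theorem theorem7 (V : finType) (G : temporal_graph V) (n m : nat)
    (hn : #|V| = n) (hm : #|edges G| = m) (m_ge1 : 1 <= m)
    (M : {set {set V}}) (hM : greedy_output G M) :
  approx_maximum_timed_matching G (1 / (avg_overlapping_number G + 1))%R M.
Proof.
have [I [-> sI Imatch leI]] := greedy_loop_spec hM; rewrite set0U.
split=> [|Mopt [[/subset_leq_card leMopt _] _]]; first by split.
rewrite avg_overlapping_numberD1 hm // mul1r invf_div.
set S := \sum_(e in _) _; rewrite -/S hm in leI leMopt *.
have S_gt0 : 0 < S.
  have : 0 < #|I| * S by apply: leq_trans leI; rewrite expn_gt0 m_ge1.
  by rewrite muln_gt0 => /andP[].
(* Clearing [S] leaves [m * #|Mopt| <= #|I| * S], with [m ^ 2] in between. *)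
rewrite mulrAC ler_pdivrMr ?ltr0n // -!natrM ler_nat.
by apply: leq_trans leI; rewrite -mulnn leq_mul2l leMopt orbT.
Qed.
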